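(* For a fixed $w\in\mathbb{R}^n$ with $|w|<1$, the map $F_w:\mathbb{H}^n\to\mathbb{H}^n$ defined by $F_w(x):=B(w)x$ is an isometry. In particular, $F_0$ is the identity map on $\mathbb{H}^n$.
   Context: Hyperboloid model: $\mathbb{H}^n=\{x\in\mathbb{R}^{n+1}: -x_0^2+x_1^2+\dots+x_n^2=-1,\ x_0>0\}$, with the Riemannian metric induced by $-x_0y_0+x_1y_1+\cdots+x_ny_n$ and geodesic distance $d(x,y)=\cosh^{-1}(x_0y_0-x_1y_1-\cdots-x_ny_n)$. For $w\in\mathbb{R}^n$ with $|w|<1$ (Euclidean norm), $w\ne0$, let $\gamma=(1-|w|^2)^{-1/2}$ and let $B(w)$ be the $(n+1)\times(n+1)$ matrix $$B(w)=\begin{bmatrix}\gamma&-\gamma w^\top\\-\gamma w&I_n+(\gamma-1)\frac{ww^\top}{|w|^2}\end{bmatrix},$$ with $B(0)=I_{n+1}$. *)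

(* Defs.v *)
From HB Require Import structures.
From mathcomp Require Import all_boot all_order all_algebra.
From mathcomp Require Import all_classical all_reals all_analysis.
From mathcomp Require Import ring lra.
Set Implicit Arguments.
Unset Strict Implicit.
Unset Printing Implicit Defensive.
Import Order.TTheory GRing.Theory Num.Theory.
Import numFieldNormedType.Exports.
Local Open Scope classical_set_scope.
Local Open Scope ring_scope.

Definition cosh (R : realType) (s : R) : R := (expR s + expR (- s)) / 2.

Definition acosh (R : realType) (t : R) : R :=
  xget 0 [set s | 0 <= s /\ cosh s = t].

Lemma acoshK (R : realType) (t : R) : 1 <= t -> 0 <= acosh t /\ cosh (acosh t) = t.
Proof.
move=> t1; rewrite /acosh; apply: (@xgetPex _ 0 [set s : R | 0 <= s /\ cosh s = t]).
have q0 : 0 <= t ^+ 2 - 1 by rewrite subr_ge0 exprn_ege1.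
have r0 := sqrtr_ge0 (t ^+ 2 - 1); have rE := sqr_sqrtr q0.
set r := Num.sqrt _ in r0 rE.
have a1 : 1 <= t + r by lra.
have a0 : 0 < t + r by lra.
exists (ln (t + r)); split; first exact: ln_ge0.
rewrite /cosh expRN lnK ?posrE//.
have -> : (t + r)^-1 = t - r.
  have an0 : t + r != 0 by rewrite gt_eqF.
  apply: (mulfI an0); rewrite divff// mulrC -subr_sqr rE; ring.
by field.
Qed.

Lemma cosh_inj_ge0 (R : realType) (s t : R) :
  0 <= s -> 0 <= t -> cosh s = cosh t -> s = t.
Proof.
move=> s0 t0; rewrite /cosh !expRN => h; apply: expR_inj.
have a1 : 1 <= expR s by rewrite -expR0 ler_expR.
have b1 : 1 <= expR t by rewrite -expR0 ler_expR.
set a := expR s in h a1 *; set b := expR t in h b1 *.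
have h2 : (a - b) * (a * b - 1) = 0.
  have an0 : a != 0 by rewrite gt_eqF// (lt_le_trans ltr01).
  have bn0 : b != 0 by rewrite gt_eqF// (lt_le_trans ltr01).
  have -> : (a - b) * (a * b - 1) =
            2 * (a * b) * ((a + a^-1) / 2 - (b + b^-1) / 2).
    by field; rewrite an0 bn0.
  by rewrite h subrr mulr0.
move/eqP: h2; rewrite mulf_eq0 => /orP[/eqP|/eqP]; first by lra.
by move=> ab; apply/eqP; rewrite eq_le; apply/andP; split; nra.
Qed.

(* The norm the library puts on ['cV[R]_n] is the sup norm. *)
Definition enorm (R : realType) (n : nat) (w : 'cV[R]_n) : R :=
  Num.sqrt (\sum_(i < n) w i 0 ^+ 2).

Definition lorentz (R : realType) (n : nat) (x y : 'cV[R]_n.+1) : R :=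
  - (x ord0 0 * y ord0 0) + \sum_(i < n) x (lift ord0 i) 0 * y (lift ord0 i) 0.

Definition hyperboloid (R : realType) (n : nat) : set 'cV[R]_n.+1 :=
  [set x | lorentz x x = -1 /\ 0 < x ord0 0].

Definition hdist (R : realType) (n : nat) (x y : 'cV[R]_n.+1) : R :=
  acosh (- lorentz x y).

Definition lorentz_factor (R : realType) (n : nat) (w : 'cV[R]_n) : R :=
  (Num.sqrt (1 - enorm w ^+ 2))^-1.

Definition boost (R : realType) (n : nat) (w : 'cV[R]_n) : 'M[R]_(1 + n) :=
  if w == 0 then 1%:M else
  block_mx (lorentz_factor w)%:M (- lorentz_factor w *: w^T)
           (- lorentz_factor w *: w)
           (1%:M + ((lorentz_factor w - 1) / enorm w ^+ 2) *: (w *m w^T)).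

(* [n.+1] and [1 + n] are convertible. *)
Definition boost_map (R : realType) (n : nat) (w : 'cV[R]_n)
    (x : 'cV[R]_n.+1) : 'cV[R]_n.+1 :=
  (boost w : 'M[R]_n.+1) *m x.

Section Smoothness.
Variables (R : realType) (V W : normedModType R).

(* On an open [U] of a finite-dimensional space, this is the usual class C^k. *)
Fixpoint Ck_on (k : nat) (U : set V) (G : V -> W) : Prop :=
  (forall x, U x -> {for x, continuous G}) /\
  if k is k'.+1 then
    forall v, (forall x, U x -> derivable G x v) /\ Ck_on k' U ('D_v G)
  else True.

(* A map defined on an arbitrary subset [A] is smooth if it locally extends
   to a smooth map on an open subset of the ambient space. *)
Definition smooth_on (A : set V) (f : V -> W) : Prop :=
  forall x, A x -> exists U : set V, exists G : V -> W,
    [/\ open U, U x, forall k, Ck_on k U G &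
        forall y, A y -> U y -> f y = G y].

End Smoothness.

(* A map of the hyperboloid is given by a map of the ambient space, of which
   only the values on the hyperboloid are relevant. *)
Definition metric_isometry (R : realType) (n : nat)
    (f : 'cV[R]_n.+1 -> 'cV[R]_n.+1) : Prop :=
  set_bij (@hyperboloid R n) (@hyperboloid R n) f /\
  forall x y, hyperboloid x -> hyperboloid y -> hdist (f x) (f y) = hdist x y.

Definition curve_at (R : realType) (n : nat) (c : R -> 'cV[R]_n.+1)
    (x : 'cV[R]_n.+1) : Prop :=
  [/\ forall t, hyperboloid (c t), c 0 = x & derivable c 0 1].

(* The tangent vectors at [x] are the velocities at 0 of the curves through [x];
   the differential of [f] at [x] maps the velocity of [c] to that of [f \o c].
   The Riemannian metric is the restriction of [lorentz] to tangent vectors. *)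
Definition preserves_metric (R : realType) (n : nat)
    (f : 'cV[R]_n.+1 -> 'cV[R]_n.+1) : Prop :=
  forall (x : 'cV[R]_n.+1) (c1 c2 : R -> 'cV[R]_n.+1),
    hyperboloid x -> curve_at c1 x -> curve_at c2 x ->
    lorentz (derive1 (f \o c1) 0) (derive1 (f \o c2) 0) =
    lorentz (derive1 c1 0) (derive1 c2 0).

Definition riemannian_isometry (R : realType) (n : nat)
    (f : 'cV[R]_n.+1 -> 'cV[R]_n.+1) : Prop :=
  [/\ set_bij (@hyperboloid R n) (@hyperboloid R n) f,
      smooth_on (@hyperboloid R n) f,
      exists g : 'cV[R]_n.+1 -> 'cV[R]_n.+1,
        smooth_on (@hyperboloid R n) g /\
        forall x, hyperboloid x -> g (f x) = x &
      preserves_metric f].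

(* Main.v *)
Require Import Defs.
From HB Require Import structures.
From mathcomp Require Import all_boot all_order all_algebra.
From mathcomp Require Import all_classical all_reals all_analysis.
From mathcomp Require Import ring lra.

Set Implicit Arguments.
Unset Strict Implicit.
Import Order.TTheory GRing.Theory Num.Theory.
Import numFieldNormedType.Exports.
Local Open Scope classical_set_scope.
Local Open Scope ring_scope.

(** The boost [boost w] is an element of the Lorentz group. In the
    decomposition of a vector into its time coordinate [x0] and its spatial
    part [u], with [g] the Lorentz factor and [k := g ^+ 2 / (1 + g)], it maps
    [(x0, u)] to [(g (x0 - w.u), u + (k (w.u) - g x0) w)], also when [w = 0].
    The relations [g ^+ 2 (1 - w.w) = 1], [k (w.w) = g - 1] and
    [k (1 + g) = g ^+ 2] then give two polynomial identities: the Lorentz form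
    is preserved ([boost_map_lorentz]) and the boost of velocity [- w] is the
    inverse of the boost of velocity [w] ([boost_mapK]).

    By the Cauchy-Schwarz inequality, [w.u < x0] on the hyperboloid
    ([hyperboloid_time_gt]), so the sign of the time coordinate is preserved,
    and boosts permute the points of the hyperboloid. Distances are preserved
    since they are functions of the Lorentz form. A boost is the restriction of
    a continuous linear map, so it is smooth, and its differential is the boost
    itself; hence the Riemannian metric, which is the Lorentz form on tangent
    vectors, is preserved too. *)

(** * Euclidean dot product *)

(** The Euclidean inner product of two column vectors. *)
Definition dot (R : realType) (n : nat) (u v : 'cV[R]_n) : R :=
  \sum_(i < n) u i 0 * v i 0.

Lemma dotC (R : realType) (n : nat) (u v : 'cV[R]_n) : dot u v = dot v u.
Proof. by apply: eq_bigr => i _; rewrite mulrC. Qed.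

Lemma dotDr (R : realType) (n : nat) (u v v' : 'cV[R]_n) :
  dot u (v + v') = dot u v + dot u v'.
Proof. by rewrite -big_split; apply: eq_bigr => i _; rewrite mxE mulrDr. Qed.

Lemma dotZr (R : realType) (n : nat) (a : R) (u v : 'cV[R]_n) :
  dot u (a *: v) = a * dot u v.
Proof. by rewrite /dot mulr_sumr; apply: eq_bigr => i _; rewrite mxE mulrCA. Qed.

Lemma dotDl (R : realType) (n : nat) (u u' v : 'cV[R]_n) :
  dot (u + u') v = dot u v + dot u' v.
Proof. by rewrite dotC dotDr !(dotC v). Qed.

Lemma dotZl (R : realType) (n : nat) (a : R) (u v : 'cV[R]_n) :
  dot (a *: u) v = a * dot u v.
Proof. by rewrite dotC dotZr dotC. Qed.

Lemma dotNl (R : realType) (n : nat) (u v : 'cV[R]_n) : dot (- u) v = - dot u v.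
Proof. by rewrite -scaleN1r dotZl mulN1r. Qed.

Lemma dot_ge0 (R : realType) (n : nat) (u : 'cV[R]_n) : 0 <= dot u u.
Proof. by apply: sumr_ge0 => i _; rewrite -expr2 sqr_ge0. Qed.

Lemma dot_eq0 (R : realType) (n : nat) (u : 'cV[R]_n) : (dot u u == 0) = (u == 0).
Proof.
apply/eqP/eqP => [u0|->]; last by rewrite -(scale0r 0) dotZr mul0r.
apply/colP => i; rewrite mxE; apply/eqP; rewrite -sqrf_eq0 expr2; apply/eqP.
by apply: (psumr_eq0P _ u0) => // j _; rewrite -expr2 sqr_ge0.
Qed.

Lemma dot_cauchy_schwarz (R : realType) (n : nat) (u v : 'cV[R]_n) :
  dot u v ^+ 2 <= dot u u * dot v v.
Proof.
have [->|u0] := eqVneq u 0.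
  by rewrite -(scale0r 0) !dotZl !mul0r expr0n.
have s0 : 0 < dot u u by rewrite lt_def dot_eq0 u0 dot_ge0.
rewrite -subr_ge0 -(pmulr_rge0 _ s0).
have := dot_ge0 (dot u u *: v + - dot u v *: u).
rewrite !(dotDl, dotDr, dotZl, dotZr) (dotC v u); congr (0 <= _); ring.
Qed.

Lemma sqr_enorm (R : realType) (n : nat) (w : 'cV[R]_n) : enorm w ^+ 2 = dot w w.
Proof.
rewrite sqr_sqrtr; first by apply: eq_bigr => i _; rewrite expr2.
by apply: sumr_ge0 => i _; rewrite sqr_ge0.
Qed.

Lemma enorm_ge0 (R : realType) (n : nat) (w : 'cV[R]_n) : 0 <= enorm w.
Proof. exact: sqrtr_ge0. Qed.

Lemma enormN (R : realType) (n : nat) (w : 'cV[R]_n) : enorm (- w) = enorm w.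
Proof. by congr Num.sqrt; apply: eq_bigr => i _; rewrite mxE sqrrN. Qed.

(** * Boosts in time and space coordinates *)

(** The spatial part of a vector of Minkowski space, that is all its
    coordinates but the one of index 0. *)
Definition space (R : realType) (n : nat) (x : 'cV[R]_n.+1) : 'cV[R]_n :=
  \col_i x (lift ord0 i) 0.

Lemma eq_time_space (R : realType) (n : nat) (x y : 'cV[R]_n.+1) :
  x ord0 0 = y ord0 0 -> space x = space y -> x = y.
Proof.
move=> xy0 xy; apply/colP => i; have [j ->|->//] := unliftP ord0 i.
by move/colP: xy => /(_ j); rewrite !mxE.
Qed.

Lemma lorentzE (R : realType) (n : nat) (x y : 'cV[R]_n.+1) :
  lorentz x y = - (x ord0 0 * y ord0 0) + dot (space x) (space y).
Proof. by congr (_ + _); apply: eq_bigr => i _; rewrite !mxE. Qed.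

Lemma lorentz_factor0 (R : realType) (n : nat) :
  lorentz_factor (0 : 'cV[R]_n) = 1.
Proof.
have d0 : dot (0 : 'cV[R]_n) 0 = 0 by apply/eqP; rewrite dot_eq0.
by rewrite /lorentz_factor sqr_enorm d0 subr0 sqrtr1 invr1.
Qed.

Lemma lorentz_factorN (R : realType) (n : nat) (w : 'cV[R]_n) :
  lorentz_factor (- w) = lorentz_factor w.
Proof. by rewrite /lorentz_factor enormN. Qed.

Lemma dot_lt1 (R : realType) (n : nat) (w : 'cV[R]_n) :
  enorm w < 1 -> dot w w < 1.
Proof. by move=> w1; rewrite -sqr_enorm expr_lt1 ?enorm_ge0. Qed.

Lemma lorentz_factor_gt0 (R : realType) (n : nat) (w : 'cV[R]_n) :
  enorm w < 1 -> 0 < lorentz_factor w.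
Proof.
by move=> /dot_lt1 w1; rewrite /lorentz_factor sqr_enorm invr_gt0 sqrtr_gt0 subr_gt0.
Qed.

Lemma sqr_lorentz_factor (R : realType) (n : nat) (w : 'cV[R]_n) :
  enorm w < 1 -> lorentz_factor w ^+ 2 * (1 - dot w w) = 1.
Proof.
move=> /dot_lt1 w1; have w0 : 0 < 1 - dot w w by rewrite subr_gt0.
by rewrite /lorentz_factor sqr_enorm exprVn sqr_sqrtr ?ltW// mulVf// gt_eqF.
Qed.

(** The coefficient of [w w^T] in the spatial block of the boost. For a nonzero
    [w] of norm less than 1 it equals [(lorentz_factor w - 1) / enorm w ^+ 2],
    and this form does not degenerate at [w = 0]. *)
Definition boost_coef (R : realType) (n : nat) (w : 'cV[R]_n) : R :=
  lorentz_factor w ^+ 2 / (1 + lorentz_factor w).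

Lemma boost_coefN (R : realType) (n : nat) (w : 'cV[R]_n) :
  boost_coef (- w) = boost_coef w.
Proof. by rewrite /boost_coef lorentz_factorN. Qed.

Lemma boost_coefM1D (R : realType) (n : nat) (w : 'cV[R]_n) :
  enorm w < 1 -> boost_coef w * (1 + lorentz_factor w) = lorentz_factor w ^+ 2.
Proof. by move=> /lorentz_factor_gt0 g0; rewrite divfK// gt_eqF// addr_gt0. Qed.

Lemma boost_coefMdot (R : realType) (n : nat) (w : 'cV[R]_n) :
  enorm w < 1 -> boost_coef w * dot w w = lorentz_factor w - 1.
Proof.
move=> w1; have g0 := lorentz_factor_gt0 w1.
have g1 : 1 + lorentz_factor w != 0 by rewrite gt_eqF// addr_gt0.
apply: (mulIf g1); rewrite mulrAC boost_coefM1D//.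
by have := sqr_lorentz_factor w1; lra.
Qed.

Lemma boostE (R : realType) (n : nat) (w : 'cV[R]_n) : enorm w < 1 ->
  boost w = block_mx (lorentz_factor w)%:M (- lorentz_factor w *: w^T)
     (- lorentz_factor w *: w) (1%:M + boost_coef w *: (w *m w^T)).
Proof.
move=> w1; rewrite /boost; have [->|w0] := eqVneq w 0.
  by rewrite lorentz_factor0 trmx0 mulmx0 !scaler0 addr0 -scalar_mx_block.
by rewrite sqr_enorm -boost_coefMdot// mulfK// dot_eq0.
Qed.

Lemma mulmx_boost (R : realType) (n : nat) (w : 'cV[R]_n) (a : 'cV[R]_1)
    (u : 'cV[R]_n) : enorm w < 1 ->
  boost w *m col_mx a u =
  col_mx (lorentz_factor w * (a 0 0 - dot w u))%:M
         (u + (boost_coef w * dot w u - lorentz_factor w * a 0 0) *: w).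
Proof.
move=> w1; have wu : w^T *m u = (dot w u)%:M.
  apply/matrixP => i j; rewrite !ord1 !mxE eqxx mulr1n.
  by apply: eq_bigr => k _; rewrite mxE.
rewrite boostE// mul_block_col -!scalemxAl mulmxDl mul1mx -scalemxAl -mulmxA wu.
rewrite [a in LHS]mx11_scalar mul_scalar_mx.
congr col_mx.
  by apply/matrixP => i j; rewrite !ord1 !mxE !eqxx !mulr1n; ring.
rewrite !mul_mx_scalar scalerBl !scalerA addrCA; congr (_ + _).
by rewrite mulNr scaleNr addrC.
Qed.

Lemma time_col_mx (R : realType) (n : nat) (a : 'cV[R]_1) (u : 'cV[R]_n) :
  (col_mx a u : 'cV[R]_n.+1) ord0 0 = a 0 0.
Proof.
have e : ord0 = lshift n (ord0 : 'I_1) :> 'I_(1 + n) by exact: val_inj.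
by rewrite e; exact: (col_mxEu a u ord0 0).
Qed.

Lemma space_col_mx (R : realType) (n : nat) (a : 'cV[R]_1) (u : 'cV[R]_n) :
  space (col_mx a u) = u.
Proof. by apply/colP => i; rewrite mxE -rshift1; exact: (col_mxEd a u i 0). Qed.

Lemma col_mx_time_space (R : realType) (n : nat) (x : 'cV[R]_n.+1) :
  x = col_mx (x ord0 0)%:M (space x).
Proof.
by apply/eq_time_space; rewrite ?space_col_mx// time_col_mx mxE eqxx mulr1n.
Qed.

Lemma boost_map_col (R : realType) (n : nat) (w : 'cV[R]_n) (x : 'cV[R]_n.+1) :
  enorm w < 1 ->
  boost_map w x =
  col_mx (lorentz_factor w * (x ord0 0 - dot w (space x)))%:M
    (space x + (boost_coef w * dot w (space x) - lorentz_factor w * x ord0 0) *: w).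
Proof.
move=> w1; rewrite /boost_map [X in _ *m X]col_mx_time_space mulmx_boost//.
by rewrite mxE eqxx mulr1n.
Qed.

Lemma boost_map_time (R : realType) (n : nat) (w : 'cV[R]_n) (x : 'cV[R]_n.+1) :
  enorm w < 1 ->
  boost_map w x ord0 0 = lorentz_factor w * (x ord0 0 - dot w (space x)).
Proof. by move=> w1; rewrite boost_map_col// time_col_mx mxE eqxx mulr1n. Qed.

Lemma boost_map_space (R : realType) (n : nat) (w : 'cV[R]_n) (x : 'cV[R]_n.+1) :
  enorm w < 1 ->
  space (boost_map w x) =
  space x + (boost_coef w * dot w (space x) - lorentz_factor w * x ord0 0) *: w.
Proof. by move=> w1; rewrite boost_map_col// space_col_mx. Qed.

Lemma boost_map0 (R : realType) (n : nat) (x : 'cV[R]_n.+1) :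
  boost_map (0 : 'cV[R]_n) x = x.
Proof. by rewrite /boost_map /boost eqxx mul1mx. Qed.

(** * Boosts preserve the hyperboloid *)

Lemma boost_map_lorentz (R : realType) (n : nat) (w : 'cV[R]_n)
    (x y : 'cV[R]_n.+1) :
  enorm w < 1 -> lorentz (boost_map w x) (boost_map w y) = lorentz x y.
Proof.
move=> w1; rewrite !lorentzE !boost_map_time// !boost_map_space//.
rewrite !(dotDl, dotDr, dotZl, dotZr) (dotC _ w).
have := sqr_lorentz_factor w1.
have := boost_coefMdot w1; have := boost_coefM1D w1.
set g := lorentz_factor w; set k := boost_coef w; set s := dot w w.
set p := dot w (space x); set q := dot w (space y).
set d := dot (space x) (space y); set a := x _ _; set b := y _ _.
move=> kg ks gs.
(* The difference of the two sides is a combination of the three relations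
   between the Lorentz factor, the coefficient and the squared norm. *)
apply/eqP; rewrite -subr_eq0; apply/eqP.
transitivity ((1 - g ^+ 2 * (1 - s)) * (a * b)
  + (k * s - (g - 1)) * (k * p * q - g * (a * q + b * p))
  + (k * (1 + g) - g ^+ 2) * (p * q)); last first.
  by rewrite kg gs ks !subrr !mul0r !addr0.
ring.
Qed.

Lemma boost_mapK (R : realType) (n : nat) (w : 'cV[R]_n) (x : 'cV[R]_n.+1) :
  enorm w < 1 -> boost_map (- w) (boost_map w x) = x.
Proof.
move=> w1; have w1N : enorm (- w) < 1 by rewrite enormN.
have gs := sqr_lorentz_factor w1.
have ks := boost_coefMdot w1; have kg := boost_coefM1D w1.
apply: eq_time_space.
  rewrite !boost_map_time// lorentz_factorN boost_map_space// dotNl dotDr dotZr.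
  rewrite mulrBl (mulrAC (boost_coef w)) ks.
  move: gs; set g := lorentz_factor w; set a := x _ _ => gs.
  by transitivity (g ^+ 2 * (1 - dot w w) * a); [ring|rewrite gs mul1r].
rewrite !boost_map_space// boost_map_time// boost_coefN lorentz_factorN.
rewrite dotNl dotDr dotZr scalerN -scaleNr -addrA -scalerDl.
rewrite -[RHS]addr0; congr (_ + _); rewrite -[RHS](scale0r w); congr (_ *: _).
rewrite mulrBl (mulrAC (boost_coef w)) ks.
move: kg; set g := lorentz_factor w; set k := boost_coef w => kg.
set a := x _ _; set p := dot w (space x).
transitivity ((k * (1 + g) - g ^+ 2) * p - (k * dot w w - (g - 1)) * g * a).
  ring.
by rewrite kg ks !subrr !mul0r subrr.
Qed.

Lemma hyperboloid_time_gt (R : realType) (n : nat) (w : 'cV[R]_n)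
    (x : 'cV[R]_n.+1) :
  enorm w < 1 -> hyperboloid x -> dot w (space x) < x ord0 0.
Proof.
move=> /dot_lt1 w1 [+ x0]; rewrite lorentzE => x1.
have := dot_cauchy_schwarz w (space x); have := dot_ge0 (space x).
by have := dot_ge0 w; nra.
Qed.

Lemma boost_map_hyperboloid (R : realType) (n : nat) (w : 'cV[R]_n)
    (x : 'cV[R]_n.+1) :
  enorm w < 1 -> hyperboloid x -> hyperboloid (boost_map w x).
Proof.
move=> w1 hx; split; first by rewrite boost_map_lorentz//; case: hx.
rewrite boost_map_time// mulr_gt0 ?lorentz_factor_gt0// subr_gt0.
exact: hyperboloid_time_gt.
Qed.

Lemma boost_map_bij (R : realType) (n : nat) (w : 'cV[R]_n) :
  enorm w < 1 ->
  set_bij (@hyperboloid R n) (@hyperboloid R n) (boost_map w).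
Proof.
move=> w1; split=> [x hx|x y _ _ xy|y hy].
- exact: boost_map_hyperboloid.
- by rewrite -(boost_mapK x w1) xy boost_mapK.
- exists (boost_map (- w) y); first by apply: boost_map_hyperboloid; rewrite ?enormN.
  by have := @boost_mapK _ _ (- w) y; rewrite opprK enormN; exact.
Qed.

(** * Smoothness and differential of continuous linear maps *)

Lemma mulmx_continuous (R : realType) (m n : nat) (M : 'M[R]_(m, n)) :
  continuous (fun x : 'cV[R]_n => M *m x).
Proof.
have -> : (fun x : 'cV[R]_n => M *m x) =
          (fun x : 'cV[R]_n => \sum_(j < n) x j 0 *: col j M).
  apply/funext => x; apply/colP => i; rewrite mxE summxE.
  by apply: eq_bigr => j _; rewrite !mxE mulrC.
have addc := @pseudometric_normed_Zmodule.add_continuous R 'cV[R]_m.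
apply: (@continuous_big _ _ _ 0 predT addc 'cV[R]_n (index_enum 'I_n)
  (fun j x => x j 0 *: col j M)) => j _ x.
apply: (@continuous_comp _ _ _ (fun x : 'cV[R]_n => x j 0) ( *:%R^~ (col j M))).
  exact: coord_continuous.
exact: scalel_continuous.
Qed.

Lemma Ck_on_cst (R : realType) (V W : normedModType R) (k : nat) (U : set V)
    (a : W) :
  Ck_on k U (cst a : V -> W).
Proof.
elim: k a => [|k IHk] a /=;
  (split; first by move=> x _; exact: cst_continuous) => //.
move=> v; split=> [x _|]; first exact: derivable_cst.
have -> : 'D_v (cst a : V -> W) = cst 0 by apply/funext => x; exact: derive_cst.
exact: IHk.
Qed.

Lemma Ck_on_linear (R : realType) (V W : normedModType R) (f : {linear V -> W})
    (k : nat) (U : set V) :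
  continuous f -> Ck_on k U f.
Proof.
move=> fc; case: k => [|k] /=; (split; first by move=> x _; exact: fc) => //.
move=> v; split=> [x _|]; first exact/diff_derivable/linear_differentiable.
have -> : 'D_v f = cst (f v).
  apply/funext => x; rewrite deriveE ?diff_lin//.
  exact: linear_differentiable.
exact: Ck_on_cst.
Qed.

Lemma smooth_on_linear (R : realType) (V W : normedModType R)
    (f : {linear V -> W}) (A : set V) :
  continuous f -> smooth_on A f.
Proof.
move=> fc x _; exists setT, f; split=> //; first exact: openT.
by move=> k; exact: Ck_on_linear.
Qed.

Lemma derive1_comp_linear (R : realType) (V W : normedModType R)
    (f : {linear V -> W}) (c : R -> V) (t : R) :
  continuous f -> derivable c t 1 -> derive1 (f \o c) t = f (derive1 c t).
Proof.
move=> fc dc; rewrite !derive1E; apply/cvg_lim => //.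
have -> : (fun h => h^-1 *: (((f \o c) \o shift t) (h *: 1) - (f \o c) t)) =
    f \o (fun h => h^-1 *: ((c \o shift t) (h *: 1) - c t)).
  by apply: funext => h /=; rewrite [RHS]linearZ [in RHS]linearB.
by apply: continuous_cvg => //; exact: fc.
Qed.

(** * Boosts are isometries *)

Lemma boost_map_smooth (R : realType) (n : nat) (w : 'cV[R]_n)
    (A : set 'cV[R]_n.+1) :
  smooth_on A (boost_map w).
Proof.
exact: (@smooth_on_linear R 'cV[R]_n.+1 'cV[R]_n.+1 (mulmx (boost w)) A
  (@mulmx_continuous R _ _ (boost w))).
Qed.

Lemma derive1_boost_map (R : realType) (n : nat) (w : 'cV[R]_n)
    (c : R -> 'cV[R]_n.+1) (t : R) :
  derivable c t 1 ->
  derive1 (boost_map w \o c) t = boost_map w (derive1 c t).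
Proof.
exact: (@derive1_comp_linear R 'cV[R]_n.+1 'cV[R]_n.+1 (mulmx (boost w)) c t
  (@mulmx_continuous R _ _ (boost w))).
Qed.

Unset Implicit Arguments.

Theorem lemma2p3 (R : realType) (n : nat) :
  (forall w : 'cV[R]_n, enorm w < 1 ->
     riemannian_isometry (boost_map w) /\ metric_isometry (boost_map w)) /\
  (forall x : 'cV[R]_n.+1, hyperboloid x -> boost_map (0 : 'cV[R]_n) x = x).
Proof.
split=> [w w1|x _]; last exact: boost_map0.
split; split.
- exact: boost_map_bij.
- exact: boost_map_smooth.
- exists (boost_map (- w)); split; first exact: boost_map_smooth.
  by move=> x _; exact: boost_mapK.
- move=> x c1 c2 _ [_ _ dc1] [_ _ dc2].
  by rewrite !derive1_boost_map// boost_map_lorentz.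
- exact: boost_map_bij.
- by move=> x y _ _; rewrite /hdist boost_map_lorentz.
Qed.
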